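(* Let $n\in\{1,2,\dots\}$ and let $\xi=n^{-1/2}W(n)$ be the function of the independent random signs $\tau(x,y)$, $(x,y)\in I$, defined in the context. Then $\hat\xi(S)=0$ for every $S\subset I$ unless $S$ is of the form $$S=\{(x_1,y_1),\dots,(x_m,y_m)\},\quad m\in\{1,\dots,n\},\quad 0\le x_1<\dots<x_m<n,$$ $$|y_1|\le x_1,\qquad |y_{k+1}-y_k|\le x_{k+1}-x_k\ \text{ for } k=1,\dots,m-1,$$ in which case $$\hat\xi(S)=\frac1{\sqrt n}\,p(x_1,y_1)\,q(S),$$ where $$q(S)=\prod_{k=1}^{m-1}\frac{p(x_{k+1}-x_k-1,\;y_{k+1}-y_k-1)-p(x_{k+1}-x_k-1,\;y_{k+1}-y_k+1)}{2}.$$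
   Context: Let $I=\{(x,y): x=0,1,\dots,n-1,\ y=-x,-x+2,\dots,x-2,x\}$. Let $\tau(x,y)$, $(x,y)\in I$, be independent random signs, each equal to $-1$ or $+1$ with probability $1/2$. Define $W(0)=0$ and $W(x+1)=W(x)+\tau(x,W(x))$ for $x=0,\dots,n-1$. For $S\subset I$ put $\tau(S)=\prod_{(x,y)\in S}\tau(x,y)$ (with $\tau(\emptyset)=1$). The Fourier-Walsh coefficients of $\xi=n^{-1/2}W(n)$ are $\hat\xi(S)=\mathbb E(\tau(S)\,\xi)$, so that $\xi=\sum_{S\subset I}\hat\xi(S)\tau(S)$. For integers $x\ge0$ and $y$ with $|y|\le x$ and $x-y$ even, $p(x,y)=2^{-x}\dfrac{x!}{\left(\frac{x-y}2\right)!\left(\frac{x+y}2\right)!}$; for all other integers $y$ (with $x\ge 0$), $p(x,y)=0$. An empty product equals $1$. *)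

(* Defs.v *)
From HB Require Import structures.
From mathcomp Require Import all_boot all_order all_algebra finmap.
From mathcomp Require Import all_classical all_reals all_analysis.

Set Implicit Arguments.
Unset Strict Implicit.
Unset Printing Implicit Defensive.

Import Order.TTheory GRing.Theory Num.Theory.

Local Open Scope classical_set_scope.
Local Open Scope ring_scope.

HB.instance Definition _ := isPointed.Build int 0.

HB.instance Definition _ := @isMeasurable.Build default_measure_display
  int (@discrete_measurable int) (@discrete_measurable0 int)
  (@discrete_measurableC int) (@discrete_measurableU int).

Definition lattice (n : nat) : {fset nat * int} :=
  [fset q in [seq (x, (2 * k)%N%:Z - x%:Z) | x <- iota 0 n, k <- iota 0 x.+1]]%fset.

Section random_signs.
Context d (Omega : measurableType d) (R : realType) (P : probability Omega R).

Definition independent d' (T' : measurableType d') (I : choiceType)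
    (D : {fset I}) (X : I -> {RV P >-> T'}) : Prop :=
  forall J : {fset I}, (J `<=` D)%fset ->
  forall A : I -> set T', (forall i, i \in J -> measurable (A i)) ->
  P (\bigcap_(i in [set` J]) (X i @^-1` A i)) =
  (\prod_(i <- J) P (X i @^-1` A i))%E.

Definition random_sign (X : {RV P >-> int}) : Prop :=
  [/\ forall w, X w = 1 \/ X w = -1,
      P [set w | X w = 1] = (2^-1 : R)%:E &
      P [set w | X w = -1] = (2^-1 : R)%:E].

Variable tau : nat * int -> {RV P >-> int}.

Fixpoint walk (x : nat) (w : Omega) : int :=
  if x is x'.+1 then walk x' w + tau (x', walk x' w) w else 0.

Definition tau_set (S : {fset nat * int}) (w : Omega) : R :=
  \prod_(q <- S) (tau q w)%:~R.

Definition xi (n : nat) (w : Omega) : R := (walk n w)%:~R / Num.sqrt n%:R.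

Definition walsh_coef (f : Omega -> R) (S : {fset nat * int}) : \bar R :=
  'E_P[fun w => (tau_set S w * f w)%R]%E.

End random_signs.

Section transition.
Variable R : realType.

(* The quotients by 2 are exact and nonnegative in the first branch. *)
Definition p (x : nat) (y : int) : R :=
  if (`|y| <= x%:Z) && (2 %| x%:Z - y)%Z then
    2 ^- x * (x`!%:R / ((`|((x%:Z - y) %/ 2)%Z|%N)`!%:R
                        * (`|((x%:Z + y) %/ 2)%Z|%N)`!%:R))
  else 0.

(* The natural subtraction x (k+1) - x k - 1 is not truncated when x is
   strictly increasing on the indices 1, ..., m, as in [chain] below. *)
Definition q (m : nat) (x : nat -> nat) (y : nat -> int) : R :=
  \prod_(1 <= k < m)
    ((p (x k.+1 - x k - 1)%N (y k.+1 - y k - 1)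
      - p (x k.+1 - x k - 1)%N (y k.+1 - y k + 1)) / 2).

End transition.

(* S = {(x 1, y 1), ..., (x m, y m)}; only the values of x and y at
   1, ..., m matter. *)
Definition chain (n : nat) (S : {fset nat * int})
    (m : nat) (x : nat -> nat) (y : nat -> int) : Prop :=
  [/\ (1 <= m <= n)%N,
      S = [fset v in [seq (x k, y k) | k <- iota 1 m]]%fset,
      (forall k, (1 <= k < m)%N -> (x k < x k.+1)%N) /\ (x m < n)%N,
      `|y 1%N| <= (x 1%N)%:Z &
      forall k, (1 <= k < m)%N ->
        `|y k.+1 - y k| <= (x k.+1)%:Z - (x k)%:Z].

(* Main.v *)
Require Import Defs.
From HB Require Import structures.
From mathcomp Require Import all_boot all_order all_algebra finmap.
From mathcomp Require Import all_classical all_reals all_analysis.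
From mathcomp Require Import zify ring.

Set Implicit Arguments.
Unset Strict Implicit.
Unset Printing Implicit Defensive.

Import Order.TTheory GRing.Theory Num.Theory.

Local Open Scope classical_set_scope.
Local Open Scope ring_scope.

(** The walk makes exactly one move out of each layer of the lattice, so
    W n is the sum over the lattice points (x, y) of 1{W x = y} tau(x, y),
    and the Walsh coefficient of W n at S is the sum over (x, y) of
    E(1{W x = y} tau(x, y) tau_S).  Since the square of a sign is 1,
    multiplying tau_S by tau(x, y) toggles the membership of (x, y) in S, so
    everything is controlled by the coefficients E(1{W x = y} tau_T), called
    [visit_coef x y T] below.  The one-step identity

      1{W (x+1) = y} = 1/2 (1{W x = y-1} (1 + tau(x, y-1))
                            + 1{W x = y+1} (1 - tau(x, y+1)))

    turns into a recursion in x for these coefficients ([visit_coefS]).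

    Two consequences of the recursion carry the proof.  The coefficient
    vanishes when T is crowded, that is, has a point at time x or later or two
    points at the same time ([visit_coef_crowded]): toggling a point of layer x
    cannot remove both obstructions, and E(tau_T) = 0 for nonempty T.
    If instead T consists of (a, b) and of points earlier than a, the
    signs met strictly after time a are averaged out, so the coefficient is
    that of T minus (a, b) at (a, b), times half the difference of the
    transition probabilities from (a + 1, b + 1) and from (a + 1, b - 1)
    ([visit_coef_last]).  Iterating gives p times q along the points
    of T ([visit_coef_points]).

    In the sum for W n only the latest point (x, y) of S can contribute, and
    then its contribution is the coefficient of the rest of S at (x, y).
    Conversely, unwinding the recursion from a nonzero coefficient forces the
    points of T into a chain, since each step moves by at most one
    ([visit_coef_neq0]). *)

(** * Transition probabilities of the simple random walk *)

Section transition_facts.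
Variable R : realType.

(** The form in which Pascal's rule applies; it holds for k > x as well, both
    sides being 0 there. *)
Lemma p_bin (x k : nat) :
  p R x ((2 * k)%N%:Z - x%:Z) = 2 ^- x * 'C(x, k)%:R.
Proof.
rewrite /p; have [kx|xk] := leqP k x; last first.
  rewrite ifF ?bin_small ?mulr0 //; apply/negP => /andP[+ _]; lia.
rewrite ifT; last by apply/andP; split; lia.
have -> : `|((x%:Z - ((2 * k)%N%:Z - x%:Z)) %/ 2)%Z|%N = (x - k)%N by lia.
have -> : `|((x%:Z + ((2 * k)%N%:Z - x%:Z)) %/ 2)%Z|%N = k by lia.
congr (_ * _); rewrite -(bin_fact kx) natrM mulnC natrM mulfK //.
Qed.

Lemma p_neq0 x y :
  p R x y != 0 -> exists2 k, (k <= x)%N & y = (2 * k)%N%:Z - x%:Z.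
Proof.
rewrite /p; case: ifP => [/andP[yx xy] _|_]; last by rewrite eqxx.
by exists `|((x%:Z + y) %/ 2)%Z|%N; lia.
Qed.

Lemma p0 y : p R 0 y = (y == 0)%:R.
Proof.
case: (eqVneq y 0) => [->|y0]; first by rewrite (p_bin 0 0) bin0 expr0 invr1 mulr1.
apply/eqP; apply: contraNT y0 => /p_neq0[k]; lia.
Qed.

(** The forward equation of the walk; at the boundary of the support it rests on
    the vanishing of one of the two terms. *)
Lemma pS x y : p R x.+1 y = (p R x (y - 1) + p R x (y + 1)) / 2.
Proof.
have [[k ky]|ny] := pselect (exists k : nat, y = (2 * k)%N%:Z - x.+1%:Z).
  have -> : y + 1 = (2 * k)%N%:Z - x%:Z by lia.
  rewrite p_bin ky; case: k ky => [|k] ky.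
    rewrite p_bin !bin0; set a := p _ _ _.
    have -> : a = 0 by apply/eqP; apply/negP => /negP/p_neq0[j]; lia.
    by rewrite add0r !mulr1 exprS invfM mulrC.
  have -> : (2 * k.+1)%N%:Z - x.+1%:Z - 1 = (2 * k)%N%:Z - x%:Z by lia.
  by rewrite !p_bin binS natrD exprS invfM; ring.
have out (e : int) : e = 1 \/ e = -1 -> p R x (y + e) = 0.
  move=> he; apply/eqP; apply/negP => /negP/p_neq0[k kx yk]; apply: ny.
  by case: he yk => -> yk; [exists k | exists k.+1]; lia.
rewrite !out ?add0r ?mul0r //; [|by left|by right].
by apply/eqP; apply/negP => /negP/p_neq0[k kx yk]; apply: ny; exists k.
Qed.

End transition_facts.

(** * Expectations of products of independent signs *)

Section random_signs_facts.
Context d (Omega : measurableType d) (R : realType) (P : probability Omega R).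

(** Every function of the walk that occurs is bounded and measurable, and this
    class, unlike integrability, is stable under products. *)
Definition bounded_mfun (f : Omega -> R) : Prop :=
  measurable_fun setT f /\ exists M, forall w, `|f w| <= M.

Lemma bounded_mfun_cst c : bounded_mfun (fun=> c).
Proof. by split; [exact: measurable_cst | exists `|c|]. Qed.

Lemma bounded_mfunD f g : bounded_mfun f -> bounded_mfun g ->
  bounded_mfun (fun w => f w + g w).
Proof.
move=> [mf [M fM]] [mg [N gN]]; split; first exact: measurable_realfun.measurable_funD.
by exists (M + N) => w; rewrite (le_trans (ler_normD _ _))// lerD.
Qed.

Lemma bounded_mfunM f g : bounded_mfun f -> bounded_mfun g ->
  bounded_mfun (fun w => f w * g w).
Proof.
move=> [mf [M fM]] [mg [N gN]]; split; first exact: measurable_realfun.measurable_funM.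
by exists (M * N) => w; rewrite normrM ler_pM.
Qed.

Lemma bounded_mfun_sum (I : eqType) (s : seq I) (f : I -> Omega -> R) :
  (forall i, i \in s -> bounded_mfun (f i)) ->
  bounded_mfun (fun w => \sum_(i <- s) f i w).
Proof.
elim: s => [|i s IHs] bf.
  by under eq_fun do rewrite big_nil; exact: bounded_mfun_cst.
under eq_fun do rewrite big_cons; apply: bounded_mfunD.
  by apply: bf; rewrite mem_head.
by apply: IHs => j js; apply: bf; rewrite in_cons js orbT.
Qed.

Lemma bounded_mfun_prod (I : eqType) (s : seq I) (f : I -> Omega -> R) :
  (forall i, i \in s -> bounded_mfun (f i)) ->
  bounded_mfun (fun w => \prod_(i <- s) f i w).
Proof.
elim: s => [|i s IHs] bf.
  by under eq_fun do rewrite big_nil; exact: bounded_mfun_cst.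
under eq_fun do rewrite big_cons; apply: bounded_mfunM.
  by apply: bf; rewrite mem_head.
by apply: IHs => j js; apply: bf; rewrite in_cons js orbT.
Qed.

Lemma bounded_mfun_integrable f :
  bounded_mfun f -> P.-integrable setT (EFin \o f).
Proof.
move=> [mf [M fM]]; apply: measurable_bounded_integrable => //.
  exact: (le_lt_trans (probability_le1 P measurableT) (ltry 1)).
exists M; split; first exact: num_real.
by move=> r Mr w _; exact: le_trans (fM w) (ltW Mr).
Qed.

Definition mean (f : Omega -> R) : R := \int[P]_w f w.

Lemma expectation_mean f : bounded_mfun f -> ('E_P[f] = (mean f)%:E)%E.
Proof.
move=> /bounded_mfun_integrable bf; rewrite unlock /mean /Rintegral fineK //.
exact: integrable_fin_num.
Qed.

Lemma eq_mean f g : f =1 g -> mean f = mean g.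
Proof. by move=> /funext ->. Qed.

Lemma mean0 : mean (fun=> 0) = 0.
Proof. by rewrite /mean Rintegral_cst // mul0r. Qed.

Lemma meanD f g : bounded_mfun f -> bounded_mfun g ->
  mean (fun w => f w + g w) = mean f + mean g.
Proof.
by move=> bf bg; rewrite /mean RintegralD //; exact: bounded_mfun_integrable.
Qed.

Lemma meanZ c f : bounded_mfun f -> mean (fun w => c * f w) = c * mean f.
Proof.
by move=> bf; rewrite /mean RintegralZl //; exact: bounded_mfun_integrable.
Qed.

Lemma mean_sum (I : eqType) (s : seq I) (f : I -> Omega -> R) :
  (forall i, i \in s -> bounded_mfun (f i)) ->
  mean (fun w => \sum_(i <- s) f i w) = \sum_(i <- s) mean (f i).
Proof.
elim: s => [|i s IHs] bf.
  by under eq_fun do rewrite big_nil; rewrite big_nil mean0.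
under eq_fun do rewrite big_cons.
have bs j : j \in s -> bounded_mfun (f j).
  by move=> js; apply: bf; rewrite in_cons js orbT.
rewrite big_cons meanD ?IHs //; last exact: bounded_mfun_sum.
by apply: bf; rewrite mem_head.
Qed.

Context (L : {fset nat * int}) (tau : nat * int -> {RV P >-> int})
  (tau_sign : forall v, v \in L -> random_sign (tau v))
  (tau_indep : independent L tau).

Lemma bounded_mfun_tau v (phi : int -> R) :
  v \in L -> bounded_mfun (fun w => phi (tau v w)).
Proof.
move=> vL; split.
  by apply: (@measurableT_comp _ _ _ _ _ _ phi) => //; exact: measurable_funP.
exists (`|phi 1| + `|phi (-1)|) => w.
have [+ _ _] := tau_sign vL => /(_ w)[]->.
  by rewrite lerDl.
by rewrite lerDr.
Qed.

Lemma bounded_mfun_tau_set (T : {fset nat * int}) :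
  (T `<=` L)%fset -> bounded_mfun (tau_set tau T).
Proof.
move=> /fsubsetP TL; apply: bounded_mfun_prod => v /TL vL.
exact: (bounded_mfun_tau (fun z => z%:~R)).
Qed.

Let up v w : R := (tau v w == 1)%:R.

(** The product of the indicators is the indicator of an intersection of
    independent events of probability 1/2. *)
Lemma mean_prod_up (J : {fset nat * int}) : (J `<=` L)%fset ->
  mean (fun w => \prod_(v <- J) up v w) = 2 ^- #|` J|.
Proof.
move=> JL; set A := \bigcap_(v in [set` J]) (tau v @^-1` [set 1]).
have mA : measurable A.
  apply: fin_bigcap_measurable => [|v _]; first exact: finite_fset.
  exact: measurable_funPTI.
have -> : (fun w => \prod_(v <- J) up v w) = \1_A.
  apply/funext => w; rewrite indicE; case: (asboolP (A w)) => Aw.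
    rewrite mem_set // big_seq big1 // => v vJ.
    by rewrite /up; have -> : tau v w = 1 by exact: (Aw v vJ).
  rewrite memNset //; have /existsNP[v /not_implyP[vJ tv]] := Aw.
  rewrite (big_fsetD1 v) //= /up; by case: eqP => // _; rewrite mul0r.
rewrite /mean /Rintegral integral_indic // setIT.
suff /(congr1 fine) : P A = (2 ^- #|` J|)%:E by [].
rewrite tau_indep // (eq_big_seq (fun=> (2^-1 : R)%:E)); last first.
  by move=> v /(fsubsetP JL)/tau_sign[].
by rewrite prodEFin big_const_seq count_predT iter_mulr_1 exprVn.
Qed.

(** Independence is given for events; writing tau v = 2 * 1{tau v = 1} - 1 moves
    the points of T into J one by one.  Each move contributes
    2 * 2^-(j+1) - 2^-j = 0 once T is reduced to that point, which is why the
    mean vanishes for every nonempty T. *)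
Lemma mean_up_tau_set (T J : {fset nat * int}) :
  (T `<=` L)%fset -> (J `<=` L)%fset -> [disjoint T & J]%fset ->
  mean (fun w => (\prod_(v <- J) up v w) * tau_set tau T w) =
  2 ^- #|` J| * (T == fset0)%:R.
Proof.
elim: {T}_.+1 {-2}T (ltnSn #|` T|) J => // k IHk T Tk J TL JL TJ.
have [->|[v vT]] := fset_0Vmem T.
  rewrite eqxx mulr1 -mean_prod_up //; apply: eq_mean => w.
  by rewrite /tau_set big_seq_fset0 mulr1.
have vL := fsubsetP TL v vT.
have vJ : v \notin J by move/fdisjointP: TJ => ->.
set T' := (T `\ v)%fset.
have T'L : (T' `<=` L)%fset by apply: fsubset_trans TL; exact: fsubD1set.
have T'k : (#|` T'| < k)%N by move: Tk; rewrite (cardfsD1 v T) vT.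
have T'J : [disjoint T' & J]%fset.
  by apply: fdisjointWl TJ; exact: fsubD1set.
have vJL : (v |` J `<=` L)%fset by rewrite fsubUset fsub1set vL.
have T'vJ : [disjoint T' & (v |` J)]%fset.
  by rewrite fdisjointXU T'J fdisjointX1 !inE eqxx.
have bup (K : {fset nat * int}) : (K `<=` L)%fset ->
    bounded_mfun (fun w => \prod_(v <- K) up v w * tau_set tau T' w).
  move=> KL; apply: bounded_mfunM; last exact: bounded_mfun_tau_set.
  apply: bounded_mfun_prod => u /(fsubsetP KL).
  exact: (bounded_mfun_tau (fun z => (z == 1)%:R)).
transitivity (mean (fun w => 2 * ((\prod_(u <- (v |` J)%fset) up u w) * tau_set tau T' w)
   + (-1) * ((\prod_(u <- J) up u w) * tau_set tau T' w))).
  apply: eq_mean => w; rewrite big_fsetU1 //= /tau_set (big_fsetD1 v vT) /=.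
  rewrite -/T'; have [+ _ _] := tau_sign vL => /(_ w) hw; rewrite /up.
  by case: hw => ->; rewrite ?mulr1z ?mulrN1z /=; ring.
rewrite meanD ?meanZ; [|by apply: bup|by apply: bup|..]; last first.
- by apply: bounded_mfunM (bounded_mfun_cst _) _; apply: bup.
- by apply: bounded_mfunM (bounded_mfun_cst _) _; apply: bup.
rewrite !IHk // cardfsU1 vJ /= exprS invfM.
have -> : (T == fset0) = false by apply/negbTE/fset0Pn; exists v.
by rewrite mulr0; field; rewrite expf_neq0.
Qed.

Lemma mean_tau_set (T : {fset nat * int}) : (T `<=` L)%fset ->
  mean (tau_set tau T) = (T == fset0)%:R.
Proof.
move=> TL; have := @mean_up_tau_set T fset0 TL (fsub0set _) (fdisjointX0 _).
rewrite cardfs0 expr0 invr1 mul1r => <-; apply: eq_mean => w.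
by rewrite big_seq_fset0 mul1r.
Qed.

End random_signs_facts.

(** * Toggling a point, crowded sets *)

Section toggling.
Implicit Types (T : {fset nat * int}) (v : nat * int).

(** The symmetric difference of T and {v}, which is the effect on index sets of
    multiplying by the sign at v. *)
Definition toggle v T : {fset nat * int} :=
  if v \in T then (T `\ v)%fset else (v |` T)%fset.

Lemma toggle_sub (L : {fset nat * int}) v T :
  v \in L -> (T `<=` L)%fset -> (toggle v T `<=` L)%fset.
Proof.
rewrite /toggle => vL TL; case: ifP => _.
  by apply: fsubset_trans TL; exact: fsubD1set.
by rewrite fsubUset fsub1set vL.
Qed.

Lemma mem_toggle v u T : u != v -> u \in T -> u \in toggle v T.
Proof. by rewrite /toggle; case: ifP => _ uv uT; rewrite !inE uT ?uv ?orbT. Qed.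

Lemma toggleU1 v T : v \notin T -> toggle v (v |` T)%fset = T.
Proof. by move=> vT; rewrite /toggle fset1U1 fsetU1K. Qed.

(** The obstructions to a correlation between tau_T and the position at time x:
    T has a sign not yet revealed at that time, or two signs of one layer, of
    which the walk meets at most one. *)
Definition crowded (x : nat) T : Prop :=
  (exists2 v, v \in T & (x <= v.1)%N) \/
  (exists u v, [/\ u \in T, v \in T, u != v & u.1 = v.1]).

Lemma crowded_leq x x' T : (x' <= x)%N -> crowded x T -> crowded x' T.
Proof.
move=> xx [[v vT xv]|]; last by right.
by left; exists v => //; exact: leq_trans xv.
Qed.

(** Only (x, y) can leave T: of two points in one layer, a survivor then has
    time x, so the first obstruction replaces the second. *)
Lemma crowded_toggle x y T : crowded x.+1 T -> crowded x (toggle (x, y) T).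
Proof.
move=> [[v vT xv]|[u [v [uT vT uv euv]]]].
  left; exists v; last exact: ltnW.
  by apply: mem_toggle => //; apply: contraTneq xv => ->; rewrite ltnn.
have [ux|ux] := eqVneq u (x, y).
  left; exists v; first by apply: mem_toggle => //; rewrite -ux eq_sym.
  by rewrite -euv ux.
have [vx|vx] := eqVneq v (x, y).
  by left; exists u; [exact: mem_toggle | rewrite euv vx].
by right; exists u, v; split => //; exact: mem_toggle.
Qed.

Lemma crowded_toggle_new x y T :
  (x, y) \notin T -> crowded x (toggle (x, y) T).
Proof.
by move=> xyT; left; exists (x, y) => //; rewrite /toggle (negbTE xyT) fset1U1.
Qed.

End toggling.

(** * Chains of lattice points *)

Section chains.
Implicit Types (x : nat -> nat) (y : nat -> int).

Definition points m x y : {fset nat * int} :=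
  [fset v in [seq (x k, y k) | k <- iota 1 m]]%fset.

Lemma points0 x y : points 0 x y = fset0.
Proof. by apply/fsetP => v; rewrite in_fset in_fset0. Qed.

Lemma pointsS m x y :
  points m.+1 x y = ((x m.+1, y m.+1) |` points m x y)%fset.
Proof.
apply/fsetP => v; rewrite in_fset1U /points !in_fset.
have -> : iota 1 m.+1 = iota 1 m ++ [:: m.+1] by have := iotaD 1 m 1; rewrite addn1 add1n.
by rewrite map_cat mem_cat mem_seq1 orbC.
Qed.

Lemma points_lt m x y : (forall k, (1 <= k <= m)%N -> (x k < x k.+1)%N) ->
  forall v, v \in points m x y -> (v.1 < x m.+1)%N.
Proof.
elim: m => [|m IHm] xlt v; first by rewrite points0.
have xm := xlt m.+1 (leqnn _); rewrite pointsS in_fset1U => /orP[/eqP->//|].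
move=> vT; apply: ltn_trans xm; apply: IHm => // k /andP[k1 km].
by apply: xlt; rewrite k1 leqW.
Qed.

Lemma eq_points m x x' y y' :
  (forall k, (k <= m)%N -> x k = x' k /\ y k = y' k) ->
  points m x y = points m x' y'.
Proof.
elim: m => [|m IHm] e; first by rewrite !points0.
by rewrite !pointsS IHm => [|k km]; [have [-> ->] := e m.+1 (leqnn _)|apply/e/leqW].
Qed.

(** A chain of length m continued by an end point (X, z) stored at index m + 1,
    and preceded by the origin stored at index 0.  The origin turns the
    condition |y 1| <= x 1 into the step condition for k = 0. *)
Definition reaches m x y (X : nat) (z : int) : Prop :=
  [/\ x m.+1 = X, y m.+1 = z,
      forall k, (1 <= k <= m)%N -> (x k < x k.+1)%N,
      x 0%N = 0%N /\ y 0%N = 0 &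
      forall k, (k <= m)%N -> `|y k.+1 - y k| <= (x k.+1)%:Z - (x k)%:Z].

Definition redirect (A : Type) m (f : nat -> A) (a : A) (k : nat) : A :=
  if (k <= m)%N then f k else a.

Lemma redirect_leq (A : Type) m (f : nat -> A) a k :
  (k <= m)%N -> redirect m f a k = f k.
Proof. by rewrite /redirect => ->. Qed.

Lemma redirect_last (A : Type) m (f : nat -> A) a : redirect m f a m.+1 = a.
Proof. by rewrite /redirect ltnn. Qed.

Lemma points_redirect m x y X z :
  points m (redirect m x X) (redirect m y z) = points m x y.
Proof. by apply: eq_points => k km; rewrite !redirect_leq. Qed.

Lemma reaches_step m x y (X : nat) (z z' : int) : reaches m x y X z' -> `|z - z'| <= 1 ->
  exists m' x' y', points m x y = points m' x' y' /\ reaches m' x' y' X.+1 z.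
Proof.
move=> [xX yz xlt [x0 y0] step] zz'.
exists m, (redirect m x X.+1), (redirect m y z).
rewrite points_redirect; split=> //; split; rewrite ?redirect_last ?redirect_leq //.
- move=> k /[dup] km /andP[_ km']; have := xlt k km.
  rewrite redirect_leq //; have [km''|mk] := ltnP k m; first by rewrite redirect_leq.
  have -> : k = m by lia.
  by rewrite redirect_last xX; lia.
- move=> k km; have := step k km; rewrite !(redirect_leq _ _ km).
  have [km'|mk] := ltnP k m; first by rewrite !redirect_leq.
  have -> : k = m by lia.
  by rewrite !redirect_last xX yz; lia.
Qed.

Lemma reaches_visit m x y (X : nat) (b z : int) : reaches m x y X b -> `|z - b| <= 1 ->
  exists m' x' y', ((X, b) |` points m x y)%fset = points m' x' y' /\
                   reaches m' x' y' X.+1 z.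
Proof.
move=> [xX yb xlt [x0 y0] step] zb.
exists m.+1, (redirect m.+1 x X.+1), (redirect m.+1 y z).
rewrite points_redirect pointsS xX yb; split=> //.
split; rewrite ?redirect_last ?redirect_leq //.
- move=> k /[dup] km /andP[k1 km'].
  rewrite redirect_leq //; have [km''|mk] := ltnP k m.+1.
    by rewrite redirect_leq // xlt // k1 -ltnS.
  have -> : k = m.+1 by lia.
  by rewrite redirect_last xX.
- move=> k km; rewrite !(redirect_leq _ _ km).
  have [km'|mk] := ltnP k m.+1; first by rewrite !redirect_leq //; exact: step.
  have -> : k = m.+1 by lia.
  by rewrite !redirect_last xX yb; lia.
Qed.

End chains.

(** * The walk *)

Lemma mem_lattice n x y :
  (x, y) \in lattice n <->
  (x < n)%N /\ exists2 k, (k <= x)%N & y = (2 * k)%N%:Z - x%:Z.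
Proof.
rewrite /lattice in_fset; split.
  move=> /allpairsPdep[a [k [+ + [-> ->]]]]; rewrite !mem_iota /= !add0n ltnS.
  by move=> -> kx; split => //; exists k.
move=> [xn [k kx ->]]; apply/allpairsPdep; exists x, k.
by rewrite !mem_iota /= !add0n ltnS.
Qed.

Section walk_facts.
Context d (Omega : measurableType d) (R : realType) (P : probability Omega R)
  (n : nat) (tau : nat * int -> {RV P >-> int})
  (tau_sign : forall v, v \in lattice n -> random_sign (tau v))
  (tau_indep : independent (lattice n) tau).

Notation L := (lattice n).
Implicit Types (T : {fset nat * int}) (v : nat * int).

Lemma walk_lattice x w : (x < n)%N -> (x, walk tau x w) \in L.
Proof.
elim: x w => [|x IHx] w xn; first by apply/mem_lattice; split => //; exists 0%N.
have xL := IHx w (ltnW xn); have /mem_lattice[_ [k kx wk]] := xL.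
apply/mem_lattice; split => //=.
have [+ _ _] := tau_sign xL => /(_ w)[]->; rewrite wk; [exists k.+1|exists k]; lia.
Qed.

Definition visit x y w : R := (walk tau x w == y)%:R.

Definition move_from x y w : R := visit x y w * (tau (x, y) w)%:~R.

Lemma visit_out x y w : (x < n)%N -> (x, y) \notin L -> visit x y w = 0.
Proof.
move=> xn xyL; rewrite /visit; case: eqP => // wy.
by move: xyL; rewrite -wy walk_lattice.
Qed.

(** The sign that matters is the one at the current position, so each indicator
    of a neighbour of y is multiplied by that of the required move. *)
Lemma visitS x y w : (x < n)%N ->
  visit x.+1 y w = 2^-1 * (visit x (y - 1) w + move_from x (y - 1) w +
                           (visit x (y + 1) w + (-1) * move_from x (y + 1) w)).
Proof.
move=> xn; have [+ _ _] := tau_sign (walk_lattice w xn) => /(_ w).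
rewrite /move_from /visit /=.
set u := walk tau x w => hu.
have at_u z : (u == z)%:R * (tau (x, z) w)%:~R = (u == z)%:R * (tau (x, u) w)%:~R :> R.
  by case: eqP => [->|]; rewrite ?mul0r.
rewrite !at_u; case: hu => ->; rewrite ?mulr1z ?mulrN1z.
  have -> : (u + 1 == y) = (u == y - 1) by lia.
  by field.
have -> : (u - 1 == y) = (u == y + 1) by lia.
by field.
Qed.

(** Off the lattice the sign is an arbitrary, possibly unbounded, integer
    variable; the product with the indicator is 0 there. *)
Lemma bounded_mfun_visit x y : (x <= n)%N -> bounded_mfun (visit x y).
Proof.
have bsign v : v \in L -> bounded_mfun (fun w => (tau v w)%:~R : R).
  by move=> vL; exact: (bounded_mfun_tau tau_sign (fun z => z%:~R)).
elim: x y => [|x IHx] y xn; first exact: bounded_mfun_cst.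
have bmove z : bounded_mfun (move_from x z).
  have [xzL|xzL] := boolP ((x, z) \in L).
    by apply: bounded_mfunM (bsign _ xzL); exact: IHx (ltnW xn).
  rewrite (_ : move_from x z = fun=> 0); first exact: bounded_mfun_cst.
  by apply/funext => w; rewrite /move_from visit_out ?mul0r.
have /funext -> := fun w => visitS y w xn.
apply: bounded_mfunM; first exact: bounded_mfun_cst.
have := ltnW xn => /IHx bx.
apply: bounded_mfunD; apply: bounded_mfunD => //.
by apply: bounded_mfunM => //; exact: bounded_mfun_cst.
Qed.

Lemma bounded_mfun_move x y : (x < n)%N -> bounded_mfun (move_from x y).
Proof.
move=> xn; have [xyL|xyL] := boolP ((x, y) \in L).
  apply: bounded_mfunM; first exact: bounded_mfun_visit (ltnW xn).
  exact: (bounded_mfun_tau tau_sign (fun z => z%:~R)).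
rewrite (_ : move_from x y = fun=> 0); first exact: bounded_mfun_cst.
by apply/funext => w; rewrite /move_from visit_out ?mul0r.
Qed.

(** * Walsh coefficients of the visits *)

Definition visit_coef x y T : R :=
  mean P (fun w => visit x y w * tau_set tau T w).

Definition move_coef x y T : R :=
  mean P (fun w => move_from x y w * tau_set tau T w).

Lemma visit_coef_out x y T :
  (x < n)%N -> (x, y) \notin L -> visit_coef x y T = 0.
Proof.
move=> xn xyL; rewrite -(mean0 P); apply: eq_mean => w.
by rewrite visit_out ?mul0r.
Qed.

Lemma move_coef_out x y T :
  (x < n)%N -> (x, y) \notin L -> move_coef x y T = 0.
Proof.
move=> xn xyL; rewrite -(mean0 P); apply: eq_mean => w.
by rewrite /move_from visit_out ?mul0r.
Qed.

Lemma tau_set_toggle v T w : v \in L ->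
  (tau v w)%:~R * tau_set tau T w = tau_set tau (toggle v T) w :> R.
Proof.
move=> vL; have vv : (tau v w)%:~R * (tau v w)%:~R = 1 :> R.
  by have [+ _ _] := tau_sign vL => /(_ w)[]->; rewrite ?mulr1z ?mulrN1z ?mulrNN mulr1.
rewrite /toggle /tau_set; case: ifPn => vT; last by rewrite big_fsetU1.
by rewrite (big_fsetD1 v vT) /= mulrA vv mul1r.
Qed.

Lemma move_coefE x y T : (x, y) \in L ->
  move_coef x y T = visit_coef x y (toggle (x, y) T).
Proof.
by move=> xyL; apply: eq_mean => w; rewrite -tau_set_toggle // mulrA.
Qed.

Lemma visit_coef0 y T : (T `<=` L)%fset ->
  visit_coef 0 y T = (y == 0)%:R * (T == fset0)%:R.
Proof.
move=> TL; transitivity (mean P (fun w => (y == 0)%:R * tau_set tau T w)).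
  by apply: eq_mean => w; rewrite /visit /= eq_sym.
rewrite meanZ; last exact: (bounded_mfun_tau_set tau_sign).
by rewrite (mean_tau_set tau_sign tau_indep TL).
Qed.

Lemma visit_coefS x y T : (x < n)%N -> (T `<=` L)%fset ->
  visit_coef x.+1 y T =
  (visit_coef x (y - 1) T + move_coef x (y - 1) T +
   (visit_coef x (y + 1) T - move_coef x (y + 1) T)) / 2.
Proof.
move=> xn TL; have bT := bounded_mfun_tau_set tau_sign TL.
have bv z : bounded_mfun (fun w => visit x z w * tau_set tau T w).
  by apply: bounded_mfunM => //; exact: bounded_mfun_visit (ltnW xn).
have bm z : bounded_mfun (fun w => move_from x z w * tau_set tau T w).
  by apply: bounded_mfunM => //; exact: bounded_mfun_move.
have bNm z : bounded_mfun (fun w => -1 * (move_from x z w * tau_set tau T w)).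
  by apply: bounded_mfunM => //; exact: bounded_mfun_cst.
transitivity (mean P (fun w => 2^-1 *
   (visit x (y - 1) w * tau_set tau T w + move_from x (y - 1) w * tau_set tau T w +
   (visit x (y + 1) w * tau_set tau T w +
    -1 * (move_from x (y + 1) w * tau_set tau T w))))).
  by apply: eq_mean => w; rewrite visitS //; ring.
rewrite meanZ; last by apply: bounded_mfunD; exact: bounded_mfunD.
rewrite meanD; [|exact: bounded_mfunD..].
by rewrite !meanD // meanZ // mulrC mulN1r.
Qed.

(** In the recursion both T and its toggles stay crowded at the previous time,
    down to time 0, where a crowded set is nonempty and E(tau_T) = 0. *)
Lemma visit_coef_crowded x y T : (x <= n)%N -> (T `<=` L)%fset ->
  crowded x T -> visit_coef x y T = 0.
Proof.
elim: x y T => [|x IHx] y T xn TL cT.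
  rewrite visit_coef0 //; have [T0|_] := eqVneq T fset0; last by rewrite mulr0.
  by move: cT => [[v]|[u [v []]]]; rewrite T0 in_fset0.
have move0 z : move_coef x z T = 0.
  have [xzL|xzL] := boolP ((x, z) \in L); last exact: move_coef_out.
  rewrite move_coefE // IHx //; [exact: ltnW|exact: toggle_sub|].
  exact: crowded_toggle.
have visit0 z : visit_coef x z T = 0.
  by apply: IHx => //; [exact: ltnW | apply: crowded_leq cT].
by rewrite visit_coefS // !move0 !visit0 !(subr0, addr0) mul0r.
Qed.

Lemma move_coef_crowded x y T : (x < n)%N -> (T `<=` L)%fset ->
  crowded x (toggle (x, y) T) -> move_coef x y T = 0.
Proof.
move=> xn TL cT; have [xyL|xyL] := boolP ((x, y) \in L).
  rewrite move_coefE // visit_coef_crowded //; first exact: ltnW.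
  exact: toggle_sub.
exact: move_coef_out.
Qed.

(** Over a layer free of points of T the walk forgets its sign: the toggled
    terms contain a point of layer x and vanish. *)
Lemma visit_coef_skip x y T : (x < n)%N -> (T `<=` L)%fset ->
  (forall v, v \in T -> v.1 != x) ->
  visit_coef x.+1 y T = (visit_coef x (y - 1) T + visit_coef x (y + 1) T) / 2.
Proof.
move=> xn TL Tx.
have move0 z : move_coef x z T = 0.
  apply: move_coef_crowded => //; apply: crowded_toggle_new.
  by apply/negP => /Tx; rewrite eqxx.
by rewrite visit_coefS // !move0 subr0 addr0.
Qed.

Lemma visit_coef_set0 x y : (x <= n)%N -> visit_coef x y fset0 = p R x y.
Proof.
elim: x y => [|x IHx] y xn; first by rewrite visit_coef0 // eqxx mulr1 p0.
by rewrite visit_coef_skip // pS !IHx // ltnW.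
Qed.

(** Only the move from (a, b) itself cancels the sign at (a, b); after any other
    move from layer a the point (a, b) remains and is as late as the walk. *)
Lemma move_coef_top a b c T : (a < n)%N -> (a, b) \in L -> (T `<=` L)%fset ->
  (forall v, v \in T -> (v.1 < a)%N) ->
  move_coef a c ((a, b) |` T)%fset = (c == b)%:R * visit_coef a b T.
Proof.
move=> an abL TL Ta.
have abTL : ((a, b) |` T `<=` L)%fset by rewrite fsubUset fsub1set abL.
have [->|cb] := eqVneq c b.
  rewrite mul1r move_coefE // toggleU1 //.
  by apply/negP => /Ta; rewrite ltnn.
rewrite mul0r; apply: move_coef_crowded => //; left; exists (a, b) => //.
apply: mem_toggle; last exact: fset1U1.
by apply: contraNneq cb => -[->].
Qed.

(** At time a + 1 the sign at (a, b) weighs the arrivals at b + 1 and b - 1 by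
    1/2 and - 1/2; from then on no point of the set is met and these two
    masses spread by the forward equation for j more steps. *)
Lemma visit_coef_last a b j z T : (a + j.+1 <= n)%N ->
  (a, b) \in L -> (T `<=` L)%fset -> (forall v, v \in T -> (v.1 < a)%N) ->
  visit_coef (a + j.+1) z ((a, b) |` T)%fset =
  visit_coef a b T * ((p R j (z - b - 1) - p R j (z - b + 1)) / 2).
Proof.
move=> + abL TL Ta.
have abTL : ((a, b) |` T `<=` L)%fset by rewrite fsubUset fsub1set abL.
elim: j z => [|j IHj] z jn.
  rewrite addn1 in jn *.
  have visit0 c : visit_coef a c ((a, b) |` T)%fset = 0.
    apply: visit_coef_crowded => //; first exact: ltnW.
    by left; exists (a, b); rewrite ?fset1U1.
  rewrite visit_coefS // !move_coef_top // !visit0.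
  rewrite !p0 (_ : (z - b - 1 == 0) = (z - 1 == b)); last lia.
  rewrite (_ : (z - b + 1 == 0) = (z + 1 == b)); last lia.
  by field.
rewrite addnS visit_coef_skip //.
- have jn' : (a + j.+1 <= n)%N by lia.
  rewrite !IHj // !pS.
  rewrite (_ : z - 1 - b - 1 = z - b - 1 - 1); last by ring.
  rewrite (_ : z - 1 - b + 1 = z - b - 1 + 1); last by ring.
  rewrite (_ : z + 1 - b - 1 = z - b + 1 - 1); last by ring.
  rewrite (_ : z + 1 - b + 1 = z - b + 1 + 1); last by ring.
  by rewrite (_ : z - b + 1 - 1 = z - b - 1 + 1); [field | ring].
- by lia.
- move=> v; rewrite in_fset1U => /orP[/eqP->|/Ta] /=; lia.
Qed.

(** * The Walsh expansion of the walk *)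

Lemma walk_sum_moves N w : (N <= n)%N ->
  (walk tau N w)%:~R =
  \sum_(v <- L) (if (v.1 < N)%N then move_from v.1 v.2 w else 0).
Proof.
elim: N => [|N IHN] Nn; first by rewrite big1.
have NL := walk_lattice w Nn.
rewrite /= rmorphD /= {1}(IHN (ltnW Nn)) !(bigD1_seq _ NL (fset_uniq _)) /=.
rewrite ltnn ltnSn add0r addrC /move_from /visit eqxx mul1r; congr (_ + _).
rewrite [LHS]big_seq_cond [RHS]big_seq_cond; apply: eq_bigr => -[a b] /= /andP[_ ab].
rewrite ltnS (leq_eqVlt a); have [aN|//] := eqVneq a N; rewrite /= aN ltnn.
case: eqP => [wb|_]; last by rewrite mul0r.
by move: ab; rewrite aN -wb eqxx.
Qed.

Lemma walsh_coef_xi S : (S `<=` L)%fset ->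
  walsh_coef tau (xi tau n) S =
  ((Num.sqrt n%:R)^-1 * \sum_(v <- L) move_coef v.1 v.2 S)%:E.
Proof.
move=> SL; have bS := bounded_mfun_tau_set tau_sign SL.
have lt_n v : v \in L -> (v.1 < n)%N by case: v => a b /mem_lattice[].
have bmove v : v \in L ->
    bounded_mfun (fun w => move_from v.1 v.2 w * tau_set tau S w).
  by move=> vL; apply: bounded_mfunM => //; apply: bounded_mfun_move; exact: lt_n.
have bsum := bounded_mfun_sum bmove.
rewrite /walsh_coef.
have -> : (fun w => tau_set tau S w * xi tau n w) =
    (fun w => (Num.sqrt n%:R)^-1 *
              \sum_(v <- L) move_from v.1 v.2 w * tau_set tau S w).
  apply/funext => w; rewrite /xi walk_sum_moves // -mulr_suml.
  rewrite (eq_big_seq (fun v => move_from v.1 v.2 w)); first by ring.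
  by move=> v vL; rewrite lt_n.
rewrite expectation_mean; last by apply: bounded_mfunM => //; exact: bounded_mfun_cst.
by rewrite meanZ // mean_sum.
Qed.

(** Each use of [visit_coef_last] removes the latest point and contributes one
    factor of q; when no point is left, the remaining coefficient is p. *)
Lemma visit_coef_points m x y :
  (forall k, (1 <= k <= m)%N -> (x k < x k.+1)%N) -> (x m.+1 <= n)%N ->
  (points m x y `<=` L)%fset ->
  visit_coef (x m.+1) (y m.+1) (points m x y) =
  p R (x 1%N) (y 1%N) * q R m.+1 x y.
Proof.
elim: m => [|m IHm] xlt xn.
  by move=> _; rewrite points0 visit_coef_set0 // /q big_geq // mulr1.
rewrite pointsS => TL; have xm : (x m.+1 < x m.+2)%N by apply: xlt; rewrite /= leqnn.
have xlt' k : (1 <= k <= m)%N -> (x k < x k.+1)%N.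
  by move=> /andP[k1 km]; apply: xlt; rewrite k1 ltnW.
have eq_x : x m.+2 = (x m.+1 + (x m.+2 - x m.+1 - 1).+1)%N by lia.
have /andP[vL T'L] : ((x m.+1, y m.+1) \in L) && (points m x y `<=` L)%fset.
  by rewrite fsubUset fsub1set in TL.
rewrite {1}eq_x visit_coef_last //; last exact: points_lt.
  rewrite IHm //; last exact: ltnW (leq_trans xm xn).
  by rewrite /q [in RHS]big_nat_recr //= -mulrA.
by rewrite -eq_x.
Qed.

(** Going back one layer from a nonzero coefficient, either the layer has no
    point of T and a neighbour of z has a nonzero coefficient, or its unique
    point is a neighbour of z and becomes the end point of a shorter chain. *)
Lemma visit_coef_neq0 X z T : (X <= n)%N -> (T `<=` L)%fset ->
  visit_coef X z T != 0 ->
  exists m x y, T = points m x y /\ reaches m x y X z.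
Proof.
elim: X z T => [|X IHX] z T Xn TL.
  rewrite visit_coef0 // => nz.
  have [z0 T0] : z = 0 /\ T = fset0.
    have [z0|z0] := eqVneq z 0; last by rewrite (negbTE z0) mul0r eqxx in nz.
    have [T0|T0] := eqVneq T fset0; last by rewrite (negbTE T0) mulr0 eqxx in nz.
    by [].
  exists 0%N, (fun=> 0%N), (fun=> 0); rewrite points0 z0; split=> //.
  by split=> // k; lia.
have [[b XbT]|noX] := pselect (exists b, (X, b) \in T); last first.
  rewrite visit_coef_skip //; last first.
    by move=> [a b] abT /=; apply/eqP => aX; apply: noX; exists b; rewrite -aX.
  move=> nz.
  have [z' z'z /IHX[||m [x [y [-> r]]]]] :
      exists2 z', `|z - z'| <= 1 & visit_coef X z' T != 0.
  - have [h|] := eqVneq (visit_coef X (z - 1) T) 0; last first.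
      by exists (z - 1) => //; lia.
    exists (z + 1); first lia.
    by apply: contraNneq nz => h'; rewrite h h' addr0 mul0r.
  - exact: ltnW.
  - by [].
  - by apply: reaches_step r z'z.
move=> nz; set T' := (T `\ (X, b))%fset.
have T'X v : v \in T' -> (v.1 < X)%N.
  rewrite in_fsetD1 => /andP[vXb vT]; rewrite ltnNge; apply/negP => Xv.
  move/eqP: nz; apply; apply: visit_coef_crowded => //.
  have [vX|vX] := eqVneq v.1 X; last first.
    by left; exists v => //; rewrite ltn_neqAle eq_sym vX Xv.
  by right; exists v, (X, b).
have defT : T = ((X, b) |` T')%fset by rewrite fsetD1K.
have T'L : (T' `<=` L)%fset by apply: fsubset_trans TL; exact: fsubD1set.
have XbL := fsubsetP TL _ XbT.
move: nz; rewrite defT -[X.+1]addn1 visit_coef_last // ?addn1 //.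
rewrite !mulf_eq0 !negb_or => /and3P[nz' nzp _].
have zb : `|z - b| <= 1.
  have [h|h] := eqVneq (z - b - 1) 0; first by lia.
  have [h'|h'] := eqVneq (z - b + 1) 0; first by lia.
  by rewrite !p0 (negbTE h) (negbTE h') subrr eqxx in nzp.
have [||m [x [y [-> r]]]] := IHX b T' _ _ nz'; [exact: ltnW | by [] |].
exact: reaches_visit r zb.
Qed.

End walk_facts.

Theorem proposition1p1 (R : realType) (d : measure_display)
    (Omega : measurableType d) (P : probability Omega R)
    (n : nat) (n_gt0 : (0 < n)%N)
    (tau : nat * int -> {RV P >-> int})
    (tau_sign : forall v, v \in lattice n -> random_sign (tau v))
    (tau_indep : independent (lattice n) tau)
    (S : {fset nat * int}) (S_sub : (S `<=` lattice n)%fset) :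
  (~ (exists m x y, chain n S m x y) ->
     walsh_coef tau (xi tau n) S = 0%E) /\
  (forall m x y, chain n S m x y ->
     walsh_coef tau (xi tau n) S =
     ((Num.sqrt n%:R)^-1 * p R (x 1%N) (y 1%N) * q R m x y)%:E).
Proof.
have lt_n v : v \in lattice n -> (v.1 < n)%N by case: v => a b /mem_lattice[].
rewrite (walsh_coef_xi tau_sign S_sub); split=> [nchain|m x y].
  rewrite big_seq big1 ?mulr0 // => -[a b] abL /=; apply/eqP.
  have an := lt_n _ abL; apply/negP => /negP nz; apply: nchain.
  (* A nonzero term forces (a, b) to be the strictly latest point of S. *)
  have ncrowded : ~ crowded a (toggle (a, b) S).
    by move=> c; rewrite (move_coef_crowded tau_sign tau_indep) ?eqxx in nz.
  have abS : (a, b) \in S.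
    by apply/negP => /negP abS; apply: ncrowded; exact: crowded_toggle_new.
  rewrite (move_coefE tau_sign) // /toggle abS in nz.
  have S'L : (S `\ (a, b) `<=` lattice n)%fset.
    by apply: fsubset_trans S_sub; exact: fsubD1set.
  have [m [x [y [defS' [xa yb xlt [x0 y0] step]]]]] :=
    visit_coef_neq0 tau_sign tau_indep (ltnW an) S'L nz.
  exists m.+1, x, y; split.
  - suff : (m <= x m.+1)%N by lia.
    elim: m xlt {xa yb step defS'} => // m IHm xlt.
    have /IHm : forall k, (1 <= k <= m)%N -> (x k < x k.+1)%N.
      by move=> k km; apply: xlt; lia.
    have := xlt m.+1; lia.
  - by rewrite -/(points m.+1 x y) pointsS -defS' xa yb fsetD1K.
  - by rewrite xa.
  - have := step 0%N isT; rewrite x0 y0; lia.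
  - by move=> k /andP[_ km]; exact: step.
case: m => [[]//|m] [/andP[_ mn] defS [xlt xn] _ _].
rewrite -/(points m.+1 x y) pointsS in defS.
have /andP[topL T'L] :
    ((x m.+1, y m.+1) \in lattice n) && (points m x y `<=` lattice n)%fset.
  by move: S_sub; rewrite defS fsubUset fsub1set.
have T'lt := points_lt (y := y) xlt.
rewrite (bigD1_seq _ topL (fset_uniq _)) /= big_seq_cond big1 ?addr0.
  rewrite {1}defS (move_coef_top tau_sign tau_indep) // eqxx mul1r.
  rewrite (visit_coef_points tau_sign tau_indep) ?mulrA //.
  exact: ltnW.
move=> [a b] /andP[abL abtop] /=; apply: (move_coef_crowded tau_sign tau_indep) => //.
  exact: lt_n abL.
have [xa|ax] := leqP a (x m.+1).
  left; exists (x m.+1, y m.+1) => //; apply: mem_toggle; first by rewrite eq_sym.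
  by rewrite defS fset1U1.
apply: crowded_toggle_new; rewrite defS in_fset1U negb_or abtop /=.
by apply/negP => /T'lt /=; lia.
Qed.
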